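(* Let $t \in \{5,6\}$. Every connected $P_t$-free graph $G$ satisfies $\mathsf{lpt}(G) \le t-2$.
   Context: All graphs are finite and simple. $P_t$ is the chordless path on $t$ vertices; a graph is $P_t$-free if it has no induced subgraph isomorphic to $P_t$. A longest path of a connected graph $G$ is a path of maximum length in $G$; a longest path transversal is a set of vertices meeting every longest path; $\mathsf{lpt}(G)$ is the minimum cardinality of a longest path transversal of $G$. *)

(* Defs.v *)
(* A finite simple graph is a symmetric irreflexive relation
   e : rel T on a finType T. *)
From mathcomp Require Import all_boot.
Set Implicit Arguments. Unset Strict Implicit. Unset Printing Implicit Defensive.

Definition gpath (T : finType) (e : rel T) (p : seq T) : bool :=
  if p is x :: q then uniq p && path e x q else false.

Definition plength (T : finType) (p : seq T) : nat := (size p).-1.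

Definition longest_path (T : finType) (e : rel T) (p : seq T) : Prop :=
  gpath e p /\ forall q, gpath e q -> plength q <= plength p.

Definition lp_transversal (T : finType) (e : rel T) (S : {set T}) : Prop :=
  forall p, longest_path e p -> exists2 x, x \in S & x \in p.

(* lpt(G) <= k, i.e. the minimum cardinality of a longest path transversal
   is at most k (there is a longest path transversal of size at most k). *)
Definition lpt_le (T : finType) (e : rel T) (k : nat) : Prop :=
  exists S : {set T}, lp_transversal e S /\ #|S| <= k.

Definition has_induced_path (T : finType) (e : rel T) (t : nat) : Prop :=
  exists f : 'I_t -> T, injective f /\
    forall i j : 'I_t, e (f i) (f j) = (i.+1 == j :> nat) || (j.+1 == i :> nat).

Definition Pt_free (T : finType) (e : rel T) (t : nat) : Prop :=
  ~ has_induced_path e t.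

Definition connected_graph (T : finType) (e : rel T) : Prop :=
  forall x y : T, connect e x y.

(* Main.v *)
(** Call the components of G - N[S] the far components of S.  For a
connected set S that misses some longest path, take such a path whose initial
segment before N(S) is as long as possible, and let B be the far component of S
containing it.  If d in N(S) is complete to B, then S + d meets every longest
path: a longest path avoiding S + d could absorb d, or a detour through S and d,
next to any vertex of B, so it avoids B; then its own initial segment before
N(S), which is no longer, can be replaced by that of the first path followed by
d and a link through S, giving a longer path.

Choose v1 and a component C of G - N[v1] with |C| maximum, and v2 in N(C).
Maximality forces every vertex outside C and N(C) to be adjacent to v2, so every
far component of {v1, v2} lies in C and touches some private neighbour of v2.
If G is P5-free such a neighbour is complete to the component.  If G is P6-free,
some private neighbour d touches all far components to which no private
neighbour is complete; a far component of {v1, v2, d} then has a complete vertex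
in N({v1, v2, d}), and four vertices suffice. *)
Require Import Defs.
From mathcomp Require Import all_boot.
From Stdlib Require Import Classical.

Set Implicit Arguments.
Unset Strict Implicit.
Unset Printing Implicit Defensive.

(** * Extremal choice, and leaving a set along a walk *)

Lemma exists_maximizer (A : Type) (P : A -> Prop) (k : A -> nat) (b : nat) :
  (forall a, P a -> k a <= b) -> (exists a, P a) ->
  exists2 a, P a & forall a', P a' -> k a' <= k a.
Proof.
(* The gap [b - k a] strictly shrinks whenever some [a'] does better. *)
move=> kb [a Pa]; have [m] := ubnP (b - k a).
elim: m a Pa => // m IHm a Pa ltm.
case: (classic (exists2 a', P a' & k a < k a')) => [[a' Pa' lt_k]|no_a'].
  apply: (IHm a' Pa'); have := kb _ Pa'; have := kb _ Pa.
  move: ltm; rewrite ltnS => ltm _ kb'; apply: leq_trans ltm.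
  exact: ltn_sub2l (leq_trans lt_k kb') lt_k.
exists a => // a' Pa'; rewrite leqNgt; apply/negP => lt_k.
by case: no_a'; exists a'.
Qed.

(** The main source of crossing edges below; [connect r x u] keeps the near end [u] in the component
    of [x]. *)
Lemma connect_exit (T : finType) (r : rel T) (P : pred T) (x y : T) :
  connect r x y -> P x -> ~~ P y -> exists u w, [/\ connect r x u, r u w, P u & ~~ P w].
Proof.
case/connectP=> p + ->; elim: p x => [|z p IHp] x /=; first by move=> _ ->.
case/andP=> rxz pz Px; case Pz: (P z) => [] nPy.
  have [u [w [czu ruw Pu nPw]]] := IHp z pz Pz nPy.
  by exists u, w; split=> //; apply: connect_trans czu; apply: connect1.
by exists x, z; rewrite Pz.
Qed.

(** * Far components and connected sets *)

Definition within (T : finType) (e : rel T) (A : {set T}) : rel T :=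
  fun x y => [&& x \in A, y \in A & e x y].
Arguments within T e A x y /.

(** Vertices of [S] may satisfy this too, so membership in [N(S)] is expressed as [d \notin S]
    together with [touches e S d]. *)
Definition touches (T : finType) (e : rel T) (S : {set T}) (x : T) : bool :=
  [exists s in S, e x s].

Definition far (T : finType) (e : rel T) (S : {set T}) : {set T} :=
  [set x | (x \notin S) && ~~ touches e S x].

(** A far component only when [x] is far; otherwise reflexivity of [connect] makes it the singleton
    of [x]. *)
Definition comp (T : finType) (e : rel T) (S : {set T}) (x : T) : {set T} :=
  [set y | connect (within e (far e S)) x y].

Definition connected_set (T : finType) (e : rel T) (S : {set T}) : Prop :=
  forall s s', s \in S -> s' \in S -> connect (within e S) s s'.

Section Graph.

Variables (T : finType) (e : rel T).
Hypotheses (e_sym : symmetric e) (e_irr : irreflexive e).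

Lemma touchesP (S : {set T}) (x : T) :
  reflect (exists2 s, s \in S & e x s) (touches e S x).
Proof. exact: exists_inP. Qed.

Lemma touches_setU1 (d : T) (S : {set T}) (x : T) :
  touches e (d |: S) x = e x d || touches e S x.
Proof.
apply/touchesP/orP => [[s /setU1P[-> ->|sS exs]]|[exd|/touchesP[s sS exs]]].
- by left.
- by right; apply/touchesP; exists s.
- by exists d; rewrite ?setU11.
- by exists s; rewrite ?inE ?sS ?orbT.
Qed.

Lemma touches_set1 (d x : T) : touches e [set d] x = e x d.
Proof.
by apply/touchesP/idP => [[s /set1P->]|exd] //; exists d; rewrite ?set11.
Qed.

Lemma far_setU1 (d : T) (S : {set T}) (x : T) :
  (x \in far e (d |: S)) = [&& x != d, ~~ e x d & x \in far e S].
Proof.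
rewrite !inE touches_setU1 !negb_or -!andbA.
by case: (x == d) (x \in S) (e x d) => [] [] [].
Qed.

Lemma far_set1 (d x : T) : (x \in far e [set d]) = (x != d) && ~~ e x d.
Proof. by rewrite !inE touches_set1. Qed.

Lemma within_sym (A : {set T}) : symmetric (within e A).
Proof. by move=> x y /=; rewrite e_sym andbCA. Qed.

Lemma connect_within_sym (A : {set T}) : connect_sym (within e A).
Proof. exact: sym_connect_sym (within_sym A). Qed.

Lemma within_sub (A B : {set T}) (x y : T) :
  A \subset B -> connect (within e A) x y -> connect (within e B) x y.
Proof.
move=> /subsetP sAB; apply: connect_sub => u w /= /and3P[uA wA euw].
by apply: connect1; rewrite /= !sAB.
Qed.

Lemma comp_far (S : {set T}) (x y : T) :
  x \in far e S -> y \in comp e S x -> y \in far e S.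
Proof.
move=> xf; rewrite inE => cxy; apply: contraLR cxy => nyf; apply/negP => cxy.
by have [u [w [_ /and3P[_ wf _] _ /negP[]]]] := connect_exit cxy xf nyf.
Qed.

Lemma comp_refl (S : {set T}) (x : T) : x \in comp e S x.
Proof. by rewrite inE. Qed.

Lemma comp_step (S : {set T}) (x y z : T) : x \in far e S ->
  y \in comp e S x -> z \in far e S -> e y z -> z \in comp e S x.
Proof.
move=> xf yC zf eyz; have yf := comp_far xf yC.
by move: yC; rewrite !inE => /connect_trans-> //; rewrite connect1 /= ?yf ?zf.
Qed.

Lemma comp_split (S : {set T}) (P : pred T) (x y z : T) : x \in far e S ->
  y \in comp e S x -> z \in comp e S x -> P y -> ~~ P z ->
  exists u w, [/\ u \in comp e S x, w \in comp e S x, e u w, P u & ~~ P w].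
Proof.
rewrite !inE => xf xy xz Py nPz.
have cyz : connect (within e (far e S)) y z.
  by apply: connect_trans xz; rewrite connect_within_sym.
have [u [w [cyu /[dup] ruw /and3P[_ _ euw] Pu nPw]]] := connect_exit cyz Py nPz.
have xu := connect_trans xy cyu.
by exists u, w; rewrite !inE; split=> //; apply: connect_trans xu (connect1 ruw).
Qed.

Lemma comp_setU1_sub (d : T) (S : {set T}) (x : T) :
  comp e (d |: S) x \subset comp e S x.
Proof.
apply/subsetP=> y; rewrite !inE; apply: within_sub.
by apply/subsetP=> z; rewrite far_setU1 => /and3P[].
Qed.

Lemma connected_set1 (v : T) : connected_set e [set v].
Proof. by move=> s s' /set1P-> /set1P->. Qed.

Lemma connected_setU1 (d : T) (S : {set T}) :
  connected_set e S -> touches e S d -> connected_set e (d |: S).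
Proof.
move=> cS /touchesP[s0 s0S ed0].
have sub := within_sub (subsetUr [set d] S).
have to_d s : s \in d |: S -> connect (within e (d |: S)) s d.
  case/setU1P=> [->//|sS]; apply: connect_trans (sub _ _ (cS _ _ sS s0S)) _.
  by apply: connect1; rewrite /= e_sym ed0 setU11 inE s0S orbT.
move=> s s' sS s'S; apply: connect_trans (to_d _ sS) _.
by rewrite connect_within_sym to_d.
Qed.

(** Supplies detours through [S]. The interior [q] has at least one vertex even if [c] and [d]
    attach to [S] at the same place, so inserting it always gains length. *)
Lemma connected_link (S : {set T}) (c d : T) :
  connected_set e S -> touches e S c -> touches e S d ->
  exists q, [/\ 0 < size q, {subset q <= S}, uniq q & path e c (rcons q d)].
Proof.
move=> cS /touchesP[s sS ecs] /touchesP[s' s'S eds'].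
have /connectP[p pp ls'] := cS _ _ sS s'S.
move: ls'; case/shortenP: pp => q pq uq _ ls'.
exists (s :: q); split=> //.
- suff: all [in S] (s :: q) by move/allP.
  rewrite /= sS /=; elim: q s pq {uq ls' sS ecs} => //= a q IHq s /andP[/and3P[_ -> _]].
  by apply: IHq.
- rewrite /= ecs rcons_path -ls' (e_sym s') eds' andbT.
  by apply: sub_path pq => a b /= /and3P[].
Qed.

(** * Surgery on longest paths *)

Lemma gpathE (p : seq T) : gpath e p = [&& p != [::], uniq p & sorted e p].
Proof. by case: p. Qed.

Lemma longest_size (p q : seq T) :
  longest_path e p -> gpath e q -> size q <= size p.
Proof.
case=> gp lp gq; have := lp _ gq; rewrite /plength.
by case: p q gp gq {lp} => [|x p] [|y q].
Qed.

Lemma longest_cons (p : seq T) (x d : T) :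
  longest_path e (x :: p) -> e d x -> d \in x :: p.
Proof.
move=> lp edx; apply: contraT => nd.
have /(longest_size lp) : gpath e [:: d, x & p].
  by case: lp => /andP[up pp] _; rewrite /gpath cons_uniq nd up /= edx.
by rewrite ltnn.
Qed.

Lemma longest_insert (p1 p2 q : seq T) (c b : T) :
  longest_path e (p1 ++ c :: b :: p2) -> 0 < size q -> uniq q ->
  ~~ has [in p1 ++ c :: b :: p2] q -> ~~ path e c (rcons q b).
Proof.
move=> lp q0 uq dis; apply/negP => pq.
have /(longest_size lp) : gpath e (p1 ++ c :: q ++ b :: p2).
  have eq_p : p1 ++ c :: q ++ b :: p2 = (p1 ++ [:: c]) ++ q ++ (b :: p2).
    by rewrite -catA.
  rewrite gpathE; apply/and3P; split; first by case: (p1).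
  - rewrite eq_p uniq_catCA cat_uniq uq -catA /= has_sym dis /=.
    by case: lp; rewrite gpathE => /and3P[].
  - case: lp; rewrite gpathE => /and3P[_ _] + _.
    rewrite !sorted_cat_cons /= => /andP[-> /andP[_ pb]] /=.
    by rewrite -cat_rcons cat_path pq last_rcons.
rewrite !size_cat /= size_cat /= !addnS !ltnS leq_add2l leqNgt.
by rewrite -{1}[size p2]add0n ltn_add2r q0.
Qed.

(** A path that avoids [S] cannot leave a far component without first visiting [N(S)]. *)
Lemma comp_prefix (S : {set T}) (x y : T) (p : seq T) :
  x \in far e S -> y \in comp e S x -> path e y p -> ~~ has [in S] p ->
  {subset take (find (touches e S) p) p <= comp e S x}.
Proof.
move=> xf; elim: p y => //= z p IHp y yC /andP[eyz pz] /norP[zS nS].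
case tz: (touches e S z) => //= u; have zC : z \in comp e S x.
  by apply: comp_step eyz; rewrite // inE zS tz.
by rewrite inE => /predU1P[->//|]; apply: (IHp z).
Qed.

Lemma longest_avoids_comp (S : {set T}) (x d : T) (p : seq T) :
  connected_set e S -> x \in far e S -> d \notin S -> touches e S d ->
  {in comp e S x, forall y, e d y} -> longest_path e p ->
  ~~ has [in d |: S] p -> ~~ has [in comp e S x] p.
Proof.
move=> cS xf dS td dom lp dis; apply/hasPn=> b bp; apply/negP => bC.
have np z : z \in d |: S -> z \notin p by apply: contraL => /(hasPn dis).
have dp := np d (setU11 _ _).
case/splitPr: bp => p1 p2 in lp dis np dp *.
(* Look at the predecessor [c] of [b] on the path. If there is none, [d] can be prepended. *)
case: (lastP p1) => [|{}p1 c] in lp dis np dp *.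
  by case/negP: dp; apply: longest_cons lp (dom b bC).
rewrite cat_rcons in lp dis np dp.
have ecb : e c b.
  case: lp; rewrite gpathE => /and3P[_ _].
  by rewrite sorted_cat_cons => /andP[_ /andP[]].
(* If [c] were in the component too, [d] would fit between [c] and [b]. *)
have nC : c \notin comp e S x.
  apply/negP => cC; have := @longest_insert p1 p2 [:: d] c b lp isT isT.
  by rewrite /= orbF dp e_sym !dom // => /(_ isT).
have cS' : c \notin S.
  apply/negP => cS'; have := np c; rewrite mem_cat !inE eqxx cS' !orbT.
  by move/(_ isT).
(* So [c] lies in [N(S)], and the edge from [c] to [b] can be replaced by a detour through [S] and
   then [d]. *)
have tc : touches e S c.
  apply: contraR nC => ntc; apply: comp_step (bC) _ _ => //.
    by rewrite inE cS'.
  by rewrite e_sym.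
have [q [q0 qS uq pq]] := connected_link cS tc td.
have := @longest_insert p1 p2 (rcons q d) c b lp.
rewrite size_rcons rcons_uniq uq (contra (qS d) dS) rcons_path pq last_rcons dom //.
suff dq : ~~ has [in p1 ++ c :: b :: p2] (rcons q d) by move/(_ isT isT dq).
apply/hasPn => z; rewrite mem_rcons inE => zq.
by apply: np; apply/setU1P; case/predU1P: zq => [|/qS]; [left | right].
Qed.

(** Reduces enlarging [S] to finding a vertex of [N(S)] complete to one particular far component,
    that of the head [x] of an extremal path missing [S]. *)
Lemma transversal_or_far (S : {set T}) : connected_set e S ->
  lp_transversal e S \/
  exists2 x, x \in far e S & forall d, d \notin S -> touches e S d ->
    {in comp e S x, forall y, e d y} -> lp_transversal e (d |: S).
Proof.
move=> cS; case: (classic (lp_transversal e S)) => [|ntS]; [by left | right].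
pose fails p := longest_path e p /\ ~~ has [in S] p.
have ex_fails : exists p, fails p.
  apply: NNPP => no; apply: ntS => p lp; case hS: (has [in S] p).
    by case/hasP: hS => x xp xS; exists x.
  by case: no; exists p; rewrite /fails hS.
have bound p : fails p -> find (touches e S) p <= #|T|.
  case=> [[+ _] _]; rewrite gpathE => /and3P[_ /card_uniqP up _].
  by apply: leq_trans (find_size _ _) _; rewrite -up max_card.
have [[|x p] [lp dis] maxp] := exists_maximizer bound ex_fails; first by case: lp.
have xS : x \notin S by case/norP: dis.
have xf : x \in far e S.
  rewrite inE xS /=; apply/touchesP => -[s sS exs].
  have: s \in x :: p by apply: longest_cons lp _; rewrite e_sym.
  by move/(hasPn dis); rewrite /= sS.
exists x => // d dS td dom p' lp'.
case has_p': (has [in d |: S] p').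
  by case/hasP: has_p' => z zp' zS; exists z.
move/negbT: has_p' => dis'; exfalso.
have np' z : z \in d |: S -> z \notin p' by apply: contraL => /(hasPn dis').
have avoid := longest_avoids_comp cS xf dS td dom lp' dis'.
(* As [d] is adjacent to the head [x], maximality puts [d] on the path, so [find] is a genuine
   position there. *)
have hasP' : has (touches e S) (x :: p).
  apply/hasP; exists d => //.
  by apply: longest_cons lp _; apply: dom; apply: comp_refl.
have eq_size : size (x :: p) = size p'.
  by apply/eqP; rewrite eqn_leq (longest_size lp (proj1 lp')) (longest_size lp' (proj1 lp)).
have le_find : find (touches e S) p' <= find (touches e S) (x :: p).
  apply: maxp; split=> //; apply: contra dis' => /hasP[z zp' zS].
  by apply/hasP; exists z; rewrite // /= inE zS orbT.
(* Both paths have the same size and [p'] has the smaller [find], so [p'] also meets [N(S)], first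
   at [n]. *)
have has' : has (touches e S) p'.
  by rewrite has_find -eq_size (leq_ltn_trans le_find) -?has_find.
set k' := find _ p' in le_find; set n := nth x p' k'.
have tn : touches e S n := nth_find x has'.
have def_p' : drop k' p' = n :: drop k'.+1 p' by rewrite -drop_nth // -has_find.
set rest := drop k'.+1 p' in def_p'.
have [q [q0 qS uq pq]] := connected_link cS td tn.
move: hasP' le_find => /=; case tx: (touches e S x) => /=.
  by move: xf; rewrite inE tx andbF.
move=> _ le_find; set t := take (find (touches e S) p) p.
have sub_t : {subset x :: t <= comp e S x}.
  move=> u; rewrite inE => /predU1P[->|]; first exact: comp_refl.
  case: lp => /andP[_ pp] _; apply: comp_prefix pp _ u => //.
    exact: comp_refl.
  by case/norP: dis.
have dC : d \notin comp e S x by apply/negP => /dom; rewrite e_irr.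
have sub_rest : {subset n :: rest <= p'}.
  by move=> z; rewrite -def_p' => /mem_drop.
(* Swap the initial segment of [p'] for [x :: t], which is at least as long, followed by [d] and the
   link [q]: a gain of at least two vertices. Disjointness holds because [x :: t] lies in the
   component, which [p'] avoids, and [p'] misses [d |: S]. *)
have: gpath e ((x :: t) ++ d :: q ++ n :: rest).
  rewrite gpathE sorted_cat_cons cat_uniq /=.
  move: (lp) => [/andP[/= /andP[xp up] pp] _]; move: (lp') => [+ _].
  rewrite gpathE => /and3P[_ up' sp'].
  apply/andP; split; last first.
    rewrite rcons_path take_path //= (e_sym _ d) dom ?sub_t ?mem_last //=.
    rewrite -cat_rcons cat_path pq last_rcons /=.
    by have := drop_sorted k' sp'; rewrite def_p'.
  rewrite (contra (@mem_take _ _ _ _) xp) take_uniq //=.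
  have sub_qr z : z \in d :: q ++ n :: rest -> z \notin x :: t.
    rewrite inE mem_cat => zq; apply/negP => /sub_t zC; case/or3P: zq.
    - by move/eqP=> zd; rewrite -zd zC in dC.
    - by move/qS=> zS; have := comp_far xf zC; rewrite inE zS.
    - by move/sub_rest => zp'; case/hasP: avoid; exists z.
  rewrite -[X in ~~ X]/(has [in x :: t] (d :: q ++ n :: rest)).
  apply/andP; split; first by apply/hasPn => z /sub_qr.
  rewrite mem_cat negb_or (contra (qS d) dS) /= (contra (@sub_rest d)) ?np' ?setU11 //=.
  rewrite cat_uniq uq -def_p' drop_uniq // andbT /=.
  apply/hasPn => z /mem_drop; apply: contraL => /qS zS.
  by apply: np'; rewrite inE zS orbT.
move/(longest_size lp'); rewrite leqNgt => /negP[].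
rewrite -[X in size X < _](cat_take_drop k') def_p' !size_cat /= size_cat /=.
rewrite !size_take_min (minn_idPl (find_size _ _)).
rewrite (leq_ltn_trans (n := (find (touches e S) p).+1 + (size rest).+1)) //.
  by rewrite leq_add2r (leq_trans (geq_minl _ _)).
by rewrite ltn_add2l !ltnS -{1}[size rest]add0n addnS ltnS leq_add2r.
Qed.

(** * Choice of the edge [v1 v2] *)

Definition private (v1 v2 : T) : {set T} :=
  [set d | [&& e d v2, ~~ e d v1 & d != v1]].

Lemma edge_with_private_attachments (v0 x0 : T) :
  connected_graph e -> x0 \in far e [set v0] ->
  exists v1 v2, e v1 v2 /\ forall y, y \in far e [set v1; v2] ->
    exists2 d, d \in private v1 v2 & exists2 b, b \in comp e [set v1; v2] y & e d b.
Proof.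
move=> conn x0f; pose P (c : T * T) := c.2 \in far e [set c.1].
have := @arg_maxnP _ (v0, x0) P (fun c => #|comp e [set c.1] c.2|) x0f.
case=> -[v1 x]; rewrite /P /= => xf maxC; set C := comp e [set v1] x in maxC.
have v1C : v1 \notin C.
  by apply/negP => /(comp_far xf); rewrite far_set1 eqxx.
have [u [v2 [_ euv2 uC v2C]]] := connect_exit (conn x v1) (comp_refl _ x) v1C.
have {}uC : u \in C by exact: uC.
have uf := comp_far xf uC.
have v2f : v2 \notin far e [set v1].
  by apply: contra v2C => v2f; apply: comp_step euv2.
have v2v1 : v2 != v1.
  by apply: contraTneq euv2 => ->; move: uf; rewrite far_set1 => /andP[].
have ev : e v1 v2 by move: v2f; rewrite far_set1 v2v1 /= negbK e_sym.
(* For [y] outside [C], all of [C] would survive as a connected set in [G - N[y]], joined there by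
   [v2]: a component larger than the maximum. *)
have far_C y : y \in far e [set v1; v2] -> y \in C.
  rewrite far_setU1 far_set1 => /and4P[yv1 ey1 yv2 ey2]; apply/negPn/negP => yC.
  have nyC c : c \in C -> ~~ e c y.
    move=> cC; apply: contra yC => ecy; apply: comp_step ecy => //.
    by rewrite far_set1 yv1.
  have sub_far : C \subset far e [set y].
    apply/subsetP => c cC; rewrite far_set1 nyC // andbT.
    by apply: contraNneq yC => <-.
  have sub_C : C \subset comp e [set y] x.
    apply/subsetP => c cC; rewrite inE.
    have cxc : connect (within e (far e [set v1])) x c by move: cC; rewrite inE.
    apply/negPn/negP => ncx.
    have [a [b [xa /and3P[af bf eab] cxa /negP[]]]] :=
      connect_exit cxc (connect0 (within e (far e [set y])) x) ncx.
    have aC : a \in C by rewrite inE.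
    have bC : b \in C by apply: comp_step eab.
    apply: connect_trans cxa (connect1 _) => /=.
    by rewrite !(subsetP sub_far) // eab.
  have xfy : x \in far e [set y] by apply: (subsetP sub_far); apply: comp_refl.
  have v2fy : v2 \in far e [set y] by rewrite far_set1 eq_sym yv2 e_sym.
  have eqC : C = comp e [set y] x.
    by apply/eqP; rewrite eqEcard sub_C; apply: (maxC (y, x)).
  case/negP: v2C; rewrite -/C eqC; apply: comp_step euv2 => //.
  by rewrite -eqC.
exists v1, v2; split=> // y yf; have yC := far_C y yf.
have cyu : connect (within e (far e [set v1])) y u.
  move: (uC) (yC); rewrite !inE => xu xy; apply: connect_trans xu.
  by rewrite connect_within_sym.
(* The walk in [C] from [y] to [u], a neighbour of [v2], must leave the far component. It leaves
   through a vertex [d] not adjacent to [v1], which is then adjacent to [v2]. *)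
have u_out : u \notin comp e [set v1; v2] y.
  by apply/negP => /(comp_far yf); rewrite far_setU1 far_set1 euv2 !andbF.
have [b [d [_ /and3P[_ df ebd] bB dB]]] := connect_exit cyu (comp_refl _ y) u_out.
exists d; last by exists b; rewrite // e_sym.
move: df; rewrite far_set1 inE => /andP[dv1 ed1]; rewrite dv1 ed1 !andbT.
apply: contraR dB => ed2; apply: comp_step ebd => //.
rewrite far_setU1 far_set1 dv1 ed1 ed2 andbT.
by apply: contraTneq ev => <-; rewrite e_sym.
Qed.

(** * Certificates for induced paths *)

(** Injectivity follows from adjacency alone, since a path on at least four vertices has no two
    vertices with equal neighbourhoods; the ends of [P_3] do have equal ones, hence the bound on
    [size s]. *)
Lemma induced_path_seq (x0 : T) (s : seq T) : 3 < size s ->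
  (forall i j, i < j < size s -> e (nth x0 s i) (nth x0 s j) = (j == i.+1)) ->
  has_induced_path e (size s).
Proof.
move=> s_gt3 Hs; exists (fun i => nth x0 s i).
have inj i j : i < j < size s -> nth x0 s i = nth x0 s j -> False.
  (* Positions [i < j] are separated by the neighbour [j.+1] of [j]; if [j] is last, by the
     neighbour [1] of [0] or the predecessor of [i]. *)
  move=> /andP[ij js] eq_ij; case: (ltnP j.+1 (size s)) => [j1s | sj1].
    have := Hs j j.+1; rewrite ltnSn j1s eqxx -eq_ij => /(_ isT).
    rewrite Hs ?(ltn_trans ij) ?ltnSn // eqSS => /eqP eq_ji.
    by rewrite eq_ji ltnn in ij.
  case: i => [|i] in ij eq_ij *.
    have j_gt2 : 2 < j by rewrite -ltnS (leq_trans s_gt3).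
    have := Hs 0 1; rewrite (ltn_trans _ s_gt3) // eq_ij e_sym => /(_ isT).
    by rewrite Hs ?(ltn_trans _ j_gt2) // => /eqP j2; rewrite j2 in j_gt2.
  have := Hs i i.+1; rewrite ltnSn (ltn_trans ij) // eqxx eq_ij => /(_ isT).
  by rewrite Hs ?(ltn_trans _ ij) // => /eqP ji; rewrite ji ltnn in ij.
split=> [i j eq_ij | i j]; first apply/val_inj.
  by case: (ltngtP i j) => // lt_ij; [have := @inj i j | have := @inj j i];
    rewrite lt_ij ltn_ord => /(_ isT); case.
case: (ltngtP i j) => [lt_ij | lt_ji | ->]; last by rewrite e_irr !gtn_eqF.
  by rewrite Hs ?lt_ij ?ltn_ord // eq_sym [X in _ || X]gtn_eqF ?orbF // ltnW.
by rewrite e_sym Hs ?lt_ji ?ltn_ord // eq_sym [X in X || _]gtn_eqF // ltnW.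
Qed.

Lemma no_induced_path5 (a b c d f : T) : Pt_free e 5 ->
  [&& e a b, e b c, e c d & e d f] ->
  ~~ [&& ~~ e a c, ~~ e a d, ~~ e a f, ~~ e b d, ~~ e b f & ~~ e c f].
Proof.
move=> free /and4P[ab bc cd df]; apply/negP => /and5P[ac ad af bd /andP[bf cf]].
apply: free; apply: (@induced_path_seq a [:: a; b; c; d; f]) => //.
by move=> [|[|[|[|[|i]]]]] [|[|[|[|[|j]]]]] //=; rewrite ?andbF // => _;
  rewrite ?ab ?bc ?cd ?df ?(negbTE ac) ?(negbTE ad) ?(negbTE af)
    ?(negbTE bd) ?(negbTE bf) ?(negbTE cf).
Qed.

Lemma no_induced_path6 (a b c d f g : T) : Pt_free e 6 ->
  [&& e a b, e b c, e c d, e d f & e f g] ->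
  [&& ~~ e a c, ~~ e a d, ~~ e a f & ~~ e a g] ->
  ~~ [&& ~~ e b d, ~~ e b f, ~~ e b g, ~~ e c f, ~~ e c g & ~~ e d g].
Proof.
move=> free /and5P[ab bc cd df fg] /and4P[ac ad af ag].
apply/negP => /and5P[bd bf bg cf /andP[cg dg]].
apply: free; apply: (@induced_path_seq a [:: a; b; c; d; f; g]) => //.
by move=> [|[|[|[|[|[|i]]]]]] [|[|[|[|[|[|j]]]]]] //=; rewrite ?andbF // => _;
  rewrite ?ab ?bc ?cd ?df ?fg
    ?(negbTE ac) ?(negbTE ad) ?(negbTE af) ?(negbTE ag)
    ?(negbTE bd) ?(negbTE bf) ?(negbTE bg)
    ?(negbTE cf) ?(negbTE cg) ?(negbTE dg).
Qed.

(** * Private neighbours against far components: the [P5] and [P6] cases *)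

Lemma comp_eq (S : {set T}) (x y z : T) :
  z \in comp e S x -> z \in comp e S y -> comp e S x = comp e S y.
Proof.
rewrite !inE => xz yz; apply/setP => w; rewrite !inE.
by rewrite (same_connect (@connect_within_sym _) xz) (same_connect (@connect_within_sym _) yz).
Qed.

Lemma privateP (v1 v2 d : T) : e v1 v2 -> d \in private v1 v2 ->
  [/\ d \notin [set v1; v2], touches e [set v1; v2] d, e d v2 & ~~ e d v1].
Proof.
rewrite inE => ev /and3P[d2 d1 dv1]; rewrite touches_setU1 touches_set1 d2 orbT.
by split=> //; rewrite !inE negb_or dv1; apply: contraTneq d2 => ->; rewrite e_irr.
Qed.

Lemma far_pair (v1 v2 x : T) : x \in far e [set v1; v2] -> ~~ e x v1 /\ ~~ e x v2.
Proof. by rewrite far_setU1 far_set1 => /and4P[]. Qed.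

(** If [d] saw only part of the component, an edge [u w] with [d] adjacent to [u] alone would give
    the induced path [w u d v2 v1]. *)
Lemma private_complete_P5 (v1 v2 d x b : T) : Pt_free e 5 -> e v1 v2 ->
  d \in private v1 v2 -> x \in far e [set v1; v2] ->
  b \in comp e [set v1; v2] x -> e d b ->
  {in comp e [set v1; v2] x, forall y, e d y}.
Proof.
move=> free ev dp xf bC edb y yC; apply/negPn/negP => ndy.
have [u [w [uC wC euw edu ndw]]] := comp_split xf bC yC edb ndy.
have [_ _ d2 d1] := privateP ev dp.
have [u1 u2] := far_pair (comp_far xf uC).
have [w1 w2] := far_pair (comp_far xf wC).
have := @no_induced_path5 w u d v2 v1 free.
by rewrite (e_sym w u) euw (e_sym u) edu d2 (e_sym v2) ev (e_sym w d)
  ndw w1 w2 u1 u2 d1 => /(_ isT).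
Qed.

Lemma three_transversal_P5 (v1 v2 : T) : Pt_free e 5 -> e v1 v2 ->
  (forall y, y \in far e [set v1; v2] ->
    exists2 d, d \in private v1 v2 & exists2 b, b \in comp e [set v1; v2] y & e d b) ->
  lpt_le e 3.
Proof.
move=> free ev attach; have cS : connected_set e [set v1; v2].
  by apply: connected_setU1; rewrite ?touches_set1 //; apply: connected_set1.
have [trS | [x xf trS]] := transversal_or_far cS.
  by exists [set v1; v2]; rewrite cards2; split=> //; case: (_ != _).
have [d dp [b bC edb]] := attach x xf; have [dS td _ _] := privateP ev dp.
exists (d |: [set v1; v2]); split.
  by apply: trS => //; apply: private_complete_P5 edb.
by rewrite cardsU1 dS cards2; case: (_ != _).
Qed.

(* Otherwise two components witnessing incomparability, joined through d and d',
   possibly via v2, give an induced P6. *)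
Lemma private_attachments_chain (v1 v2 d d' x y : T) : Pt_free e 6 -> e v1 v2 ->
  d \in private v1 v2 -> d' \in private v1 v2 ->
  x \in far e [set v1; v2] -> y \in far e [set v1; v2] ->
  [exists b in comp e [set v1; v2] x, e d b] ->
  ~~ [forall b in comp e [set v1; v2] x, e d b] ->
  [exists b in comp e [set v1; v2] y, e d' b] ->
  ~~ [forall b in comp e [set v1; v2] y, e d' b] ->
  ~~ [exists b in comp e [set v1; v2] y, e d b] ->
  [exists b in comp e [set v1; v2] x, e d' b].
Proof.
move=> free ev dp dp' xf yf /exists_inP[b bC edb] /forall_inPn[c cC ndc].
move=> /exists_inP[b' bC' edb'] /forall_inPn[c' cC' ndc'] ndy; apply: contraT => ndx.
have [u [w [uC wC euw edu ndw]]] := comp_split xf bC cC edb ndc.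
have [u' [w' [uC' wC' euw' edu' ndw']]] := comp_split yf bC' cC' edb' ndc'.
have ndy' z : z \in comp e [set v1; v2] y -> ~~ e d z.
  by move=> zC; apply: contra ndy => edz; apply/exists_inP; exists z.
have ndx' z : z \in comp e [set v1; v2] x -> ~~ e d' z.
  by move=> zC; apply: contra ndx => edz; apply/exists_inP; exists z.
(* An edge between the two components would merge them, and [d'] would then attach to the first. *)
have far_xy z z' : z \in comp e [set v1; v2] x -> z' \in comp e [set v1; v2] y -> ~~ e z z'.
  move=> zC zC'; apply/negP => ezz'.
  have zC2 : z' \in comp e [set v1; v2] x.
    by apply: comp_step ezz'; rewrite // (comp_far yf zC').
  have bCx : b' \in comp e [set v1; v2] x by rewrite (comp_eq zC2 zC').
  by case/negP: (ndx' b' bCx).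
have [_ _ d2 _] := privateP ev dp; have [_ _ d2' _] := privateP ev dp'.
have [_ u2] := far_pair (comp_far xf uC); have [_ w2] := far_pair (comp_far xf wC).
have [_ u2'] := far_pair (comp_far yf uC').
case edd' : (e d d').
  have := @no_induced_path6 w u d d' u' w' free.
  rewrite (e_sym w u) euw (e_sym u d) edu edd' edu' euw' (e_sym w d) ndw.
  rewrite (e_sym w d') ndx' // (e_sym u d') ndx' //.
  rewrite (far_xy w u') // (far_xy w w') // (far_xy u u') // (far_xy u w') //.
  by rewrite (ndy' u') // (ndy' w') // ndw' => /(_ isT isT).
have := @no_induced_path6 w u d v2 d' u' free.
rewrite (e_sym w u) euw (e_sym u d) edu d2 (e_sym v2) d2' edu' (e_sym w d) ndw.
rewrite w2 (e_sym w d') ndx' // (e_sym u d') ndx' // (far_xy w u') // (far_xy u u') //.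
by rewrite u2 edd' (ndy' u') // (e_sym v2) u2' => /(_ isT isT).
Qed.

Lemma four_transversal_P6 (v1 v2 : T) : Pt_free e 6 -> e v1 v2 ->
  (forall y, y \in far e [set v1; v2] ->
    exists2 d, d \in private v1 v2 & exists2 b, b \in comp e [set v1; v2] y & e d b) ->
  lpt_le e 4.
Proof.
move=> free ev attach; have cS : connected_set e [set v1; v2].
  by apply: connected_setU1; rewrite ?touches_set1 //; apply: connected_set1.
have [trS | [x0 x0f _]] := transversal_or_far cS.
  by exists [set v1; v2]; rewrite cards2; split=> //; case: (_ != _).
set S := [set v1; v2] in attach cS x0f *.
pose attached d x := [exists b in comp e S x, e d b].
pose complete d x := [forall b in comp e S x, e d b].
(* A component is represented by all its vertices, so counting vertices of [mixed] weights each
   component by its size; inclusion arguments are unaffected. *)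
pose mixed := [set x in far e S | [forall d in private v1 v2, ~~ complete d x]].
have [d0 d0p _] := attach x0 x0f.
have := @arg_maxnP _ d0 [in private v1 v2] (fun d => #|[set x in mixed | attached d x]|) d0p.
case=> d dp maxd; have [dS td d2 d1] := privateP ev dp.
(* If [d] missed the component of [x], a private neighbour [d'] attached there would attach to every
   mixed component that [d] reaches and to one more, against the choice of [d]. *)
have d_mixed x : x \in mixed -> attached d x.
  move=> xm; apply: contraT => ndx; move: (xm); rewrite inE => /andP[xf ncx].
  have [d' dp' [b' bC' edb']] := attach x xf.
  have d'x : attached d' x by apply/exists_inP; exists b'.
  suff lt_d : #|[set y in mixed | attached d y]| < #|[set y in mixed | attached d' y]|.
    by have := leq_trans lt_d (maxd d' dp'); rewrite ltnn.
  apply/proper_card/properP; split; last first.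
    by exists x; rewrite inE xm ?d'x // negb_and ndx orbT.
  apply/subsetP => y; rewrite inE => /andP[ym dy]; rewrite inE ym /=.
  move: ym; rewrite inE => /andP[yf ncy].
  apply: private_attachments_chain dy _ d'x _ ndx => //.
    exact: (forall_inP ncy).
  exact: (forall_inP ncx).
have cS1 : connected_set e (d |: S) by apply: connected_setU1.
have card_S1 : #|d |: S| <= 3 by rewrite cardsU1 dS cards2; case: (_ != _).
have [trS1 | [x xf1 trS1]] := transversal_or_far cS1.
  by exists (d |: S); split=> //; apply: leq_trans card_S1 _.
suff [z [zS1 tz zC]] : exists z, [/\ z \notin d |: S, touches e (d |: S) z &
    {in comp e (d |: S) x, forall y, e z y}].
  exists (z |: (d |: S)); split; first exact: trS1.
  by rewrite cardsU1 zS1.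
have /and3P[xd nexd xf] : [&& x != d, ~~ e x d & x \in far e S] by rewrite -far_setU1.
(* Outside [mixed], some private [f] is complete to the component for [S], hence to the smaller one
   for [d |: S]. *)
case xm: (x \in mixed); last first.
  move: xm; rewrite inE xf /= => /negbT/forall_inPn[f fp /negPn/forall_inP fC].
  have [fS tf _ _] := privateP ev fp; exists f; split.
  - rewrite in_setU1 negb_or fS andbT; apply: contraNneq nexd => <-.
    by rewrite e_sym fC // comp_refl.
  - by rewrite touches_setU1 tf orbT.
  - by move=> y /(subsetP (comp_setU1_sub _ _ _)); apply: fC.
have /exists_inP[b bC edb] := d_mixed x xm.
have bC1 : b \notin comp e (d |: S) x.
  by apply/negP => /(comp_far xf1); rewrite far_setU1 e_sym edb andbF.
move: bC; rewrite inE => cxb.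
(* Walking towards the neighbour [b] of [d], the first vertex [z] outside the smaller component is
   far from [S] but adjacent to [d]. *)
have [y [z [_ /and3P[_ zf eyz] yC1 zC1]]] := connect_exit cxb (comp_refl _ x) bC1.
have zd : z != d by apply: contraTneq zf => ->; rewrite inE td andbF.
have ezd : e z d.
  apply: contraR zC1 => nezd; apply: comp_step eyz => //.
  by rewrite far_setU1 zd nezd.
have zS : z \notin S by move: zf; rewrite inE => /andP[].
exists z; split; first by rewrite in_setU1 negb_or zd.
  by rewrite touches_setU1 ezd.
(* Were [z] not complete, an edge [u w] with only [u] adjacent to [z] would give the induced path
   [w u z d v2 v1]. *)
move=> c cC1; apply/negPn/negP => nezc; rewrite e_sym in eyz.
have [u [w [uC wC euw ezu nezw]]] := comp_split xf1 yC1 cC1 eyz nezc.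
have /and3P[_ ud uf] : [&& u != d, ~~ e u d & u \in far e S].
  by rewrite -far_setU1; apply: comp_far uC.
have /and3P[_ wd wf] : [&& w != d, ~~ e w d & w \in far e S].
  by rewrite -far_setU1; apply: comp_far wC.
have [u1 u2] := far_pair uf; have [w1 w2] := far_pair wf; have [z1 z2] := far_pair zf.
have := @no_induced_path6 w u z d v2 v1 free.
rewrite (e_sym w u) euw (e_sym u z) ezu ezd d2 (e_sym v2) ev (e_sym w z) nezw.
by rewrite wd w1 w2 ud u1 u2 z1 z2 d1 => /(_ isT isT).
Qed.

End Graph.

Theorem theorem3p4 (t : nat) (T : finType) (e : rel T)
  (e_sym : symmetric e) (e_irr : irreflexive e) :
  (t = 5 \/ t = 6) ->
  connected_graph e -> Pt_free e t -> lpt_le e (t - 2).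
Proof.
move=> t56 conn free; case: (pickP [pred x : T | true]) => [v0 _ | noT]; last first.
  by exists set0; rewrite cards0; split=> // -[|x p] [] // _ _; have := noT x.
(* Either one vertex suffices, or [v0] has a far vertex, which starts the maximization over
   pairs. *)
have [tr | [x0 x0f _]] := transversal_or_far e_sym e_irr (@connected_set1 _ e v0).
  by exists [set v0]; rewrite cards1; split=> //; case: t56 => ->.
have [v1 [v2 [ev attach]]] := edge_with_private_attachments e_sym conn x0f.
case: t56 free => -> free; first exact: three_transversal_P5 attach.
exact: four_transversal_P6 attach.
Qed.
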